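(* Let $W=\sum_{j=1}^{N}\prod_{i=1}^{N}X_i^{p_{ij}}\colon\mathbb{C}^N\to\mathbb{C}$ and let $G\le(\mathbb{C}^\times)^N$ be a group under which $W$ is invariant. Assume that the matrix $P=(p_{ij})$ is invertible (over $\mathbb{Q}$). Then the Krawitz dual group $G^\dagger$ equals $G^T$ (as subgroups of $(\mathbb{C}^\times)^N$).
   Context: For an abelian group $H$ that is a finite direct sum of algebraic tori and finitely generated groups (or isomorphic to such), $F(H)=\operatorname{Hom}(H,\mathbb{C}^\times)$ and $H^\tau=\operatorname{Hom}(H,\mathbb{Z})$, with homomorphisms of algebraic groups; both are contravariant functors, and $F(\mathbb{Z}^N)=(\mathbb{C}^\times)^N$, $F((\mathbb{C}^\times)^N)=\mathbb{Z}^N$. Exponents $p_{ij}$ are nonnegative integers and the group $(\mathbb{C}^\times)^N$ acts on $\mathbb{C}^N$ by coordinatewise multiplication. View $P$ as a map $\mathbb{Z}^N\to\mathbb{Z}^N$. Definition of $G^T$. Let $M=F((\mathbb{C}^\times)^N/G)$ and let $A=F(\text{quotient map})\colon M\to\mathbb{Z}^N$ be the inclusion of the lattice of $G$-invariant characters. Since $W$ is $G$-invariant, $P$ factors uniquely as $P=A\circ B^\tau$ with $B^\tau\colon\mathbb{Z}^N\to M$. Let $B\colon M^\tau\to(\mathbb{Z}^N)^\tau$ be the transpose of $B^\tau$. Then $G^T=\ker F(B)\le F((\mathbb{Z}^N)^\tau)=(\mathbb{C}^\times)^N$ (using the standard dual basis of $(\mathbb{Z}^N)^\tau$). Definition of the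 Krawitz dual $G^\dagger$. Let $\rho_1,\dots,\rho_N$ be the columns and $\overline\rho_1,\dots,\overline\rho_N$ the rows of $(P^\tau)^{-1}$, where $P^\tau$ is the transpose of $P$. Put $g_k=\exp(2\pi i\rho_k)\in(\mathbb{C}^\times)^N$ and $\overline g_k=\exp(2\pi i\overline\rho_k)\in(\mathbb{C}^\times)^N$, with $\exp(2\pi i\,\cdot)$ applied entrywise. Then $G^\dagger$ is the set of elements $\overline g_1^{\,r_1}\cdots\overline g_N^{\,r_N}\in(\mathbb{C}^\times)^N$, with $r_1,\dots,r_N\in\mathbb{Z}$, such that $$[r_1,\dots,r_N]\,(P^\tau)^{-1}\begin{bmatrix}a_1\\ \vdots\\ a_N\end{bmatrix}\in\mathbb{Z}$$ for all $a_1,\dots,a_N\in\mathbb{Z}$ with $g_1^{a_1}\cdots g_N^{a_N}\in G$. *)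

(* Defs.v *)
From HB Require Import structures.
From mathcomp Require Import all_boot all_order all_algebra.
From mathcomp Require Import complex.
From mathcomp Require Import boolp classical_sets reals trigo.

Set Implicit Arguments.
Unset Strict Implicit.
Unset Printing Implicit Defensive.

Import Order.TTheory GRing.Theory Num.Theory.

Local Open Scope ring_scope.
Local Open Scope classical_set_scope.
Local Open Scope complex_scope.

Definition expgz (gT : groupType) (x : gT) (n : int) : gT :=
  match n with
  | Posz k => (x ^+ k)%g
  | Negz k => (x ^- k.+1)%g
  end.

Section Cstar.
Variable R : realType.

Record Cstar := MkCstar { cval :> R[i]; _ : cval != 0 }.

HB.instance Definition _ := [isSub for cval].
HB.instance Definition _ := [Choice of Cstar by <:].

Implicit Types x y z : Cstar.

Lemma cval_neq0 x : cval x != 0. Proof. by case: x. Qed.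

Definition cone : Cstar := MkCstar (oner_neq0 _).

Fact cmul_subproof x y : cval x * cval y != 0.
Proof. by rewrite mulf_neq0 ?cval_neq0. Qed.
Definition cmul x y : Cstar := MkCstar (cmul_subproof x y).

Fact cinv_subproof x : (cval x)^-1 != 0.
Proof. by rewrite invr_eq0 cval_neq0. Qed.
Definition cinv x : Cstar := MkCstar (cinv_subproof x).

Fact cmulA : associative cmul.
Proof. by move=> x y z; apply/val_inj; rewrite /= mulrA. Qed.
Fact cmul1 : left_id cone cmul.
Proof. by move=> x; apply/val_inj; rewrite /= mul1r. Qed.
Fact cmulr1 : right_id cone cmul.
Proof. by move=> x; apply/val_inj; rewrite /= mulr1. Qed.
Fact cmulV : left_inverse cone cinv cmul.
Proof. by move=> x; apply/val_inj; rewrite /= mulVf ?cval_neq0. Qed.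
Fact cmulrV : right_inverse cone cinv cmul.
Proof. by move=> x; apply/val_inj; rewrite /= mulfV ?cval_neq0. Qed.

HB.instance Definition _ :=
  isGroup.Build Cstar cmulA cmul1 cmulr1 cmulV cmulrV.

Lemma cval1 : cval 1%g = 1. Proof. by []. Qed.
Lemma cvalM x y : cval (x * y)%g = cval x * cval y. Proof. by []. Qed.
Lemma cvalV x : cval x^-1%g = (cval x)^-1. Proof. by []. Qed.
Lemma cvalX x n : cval (x ^+ n)%g = cval x ^+ n.
Proof. by elim: n => [//|n IHn]; rewrite expgS exprS cvalM IHn. Qed.
Lemma cvalXz x (n : int) : cval (expgz x n) = cval x ^ n.
Proof. by case: n => n; rewrite /= ?cvalV cvalX. Qed.
Lemma cval_prod (I : finType) (E : I -> Cstar) :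
  cval (\prod_i E i)%g = \prod_i cval (E i).
Proof. exact: (big_morph cval cvalM cval1). Qed.

(* Euler's formula for exp(2 pi i x), x real *)
Fact exp2pii_subproof (x : R) :
  (cos (2 * pi * x) +i* sin (2 * pi * x)) != 0 :> R[i].
Proof.
apply/eqP=> -[c0 s0]; have := cos2Dsin2 (2 * pi * x).
by rewrite c0 s0 expr0n /= addr0 => /eqP; rewrite eq_sym oner_eq0.
Qed.
Definition exp2pii (x : R) : Cstar := MkCstar (exp2pii_subproof x).

End Cstar.

Notation torus R N := {ffun 'I_N -> Cstar R}.

(* H^tau = Hom(H, Z), as an abelian group under pointwise addition *)
Definition tau (H : zmodType) : Type := {additive H -> int}.

Section Tau.
Variable H : zmodType.

HB.instance Definition _ := gen_eqMixin (tau H).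
HB.instance Definition _ := gen_choiceMixin (tau H).

Definition tau_fun (f : tau H) : H -> int := (f : {additive H -> int}).

Lemma tau_ext (f g : tau H) : tau_fun f =1 tau_fun g -> f = g.
Proof.
move: f g => [f [[fP]]] [g [[gP]]] /funext /= fg.
move: fg fP gP; rewrite /tau_fun /= => -> fP gP.
by rewrite (Prop_irrelevance fP gP).
Qed.

Definition tau_zero : tau H := \0.
Definition tau_opp (f : tau H) : tau H := \- (f : {additive H -> int}).
Definition tau_add (f g : tau H) : tau H :=
  (f : {additive H -> int}) \+ (g : {additive H -> int}).

Fact tau_addA : associative tau_add.
Proof. by move=> f g h; apply: tau_ext => x; apply: addrA. Qed.
Fact tau_addC : commutative tau_add.
Proof. by move=> f g; apply: tau_ext => x; apply: addrC. Qed.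
Fact tau_add0 : left_id tau_zero tau_add.
Proof. by move=> f; apply: tau_ext => x; apply: add0r. Qed.
Fact tau_addN : left_inverse tau_zero tau_opp tau_add.
Proof. by move=> f; apply: tau_ext => x; apply: addNr. Qed.

HB.instance Definition _ :=
  GRing.isZmodule.Build (tau H) tau_addA tau_addC tau_add0 tau_addN.
End Tau.

Definition tau_map (H K : zmodType) (f : {additive H -> K}) (b : tau K) :
  tau H := (b : {additive K -> int}) \o f.

Fact tau_map_nmod_morphism (H K : zmodType) (f : {additive H -> K}) :
  nmod_morphism (tau_map f).
Proof. by split=> [|b c]; apply: tau_ext. Qed.
HB.instance Definition _ (H K : zmodType) (f : {additive H -> K}) :=
  GRing.isNmodMorphism.Build (tau K) (tau H) (tau_map f)
    (tau_map_nmod_morphism f).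

(* F(H) = Hom(H, C^x) for a lattice H, on which every homomorphism is
   algebraic; [to_multiplicative H] is H written multiplicatively *)
Definition F (R : realType) (H : zmodType) : Type :=
  UMagmaMorphism.type (GRing.to_multiplicative H) (Cstar R).

Definition F_fun (R : realType) (H : zmodType) (chi : F R H) (x : H) :
  Cstar R :=
  (chi : UMagmaMorphism.type (GRing.to_multiplicative H) (Cstar R)) x.

Definition F_map (R : realType) (H K : zmodType) (f : {additive H -> K})
    (chi : F R K) : F R H :=
  (chi : UMagmaMorphism.type (GRing.to_multiplicative K) (Cstar R))
    \o GRing.to_fmultiplicative f.

Definition in_kerF (R : realType) (H K : zmodType) (f : {additive H -> K})
    (chi : F R K) : Prop :=
  forall x : H, F_fun (F_map f chi) x = 1%g.

Section Lattices.
Variables (R : realType) (N : nat).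
Implicit Types (G : set (torus R N)) (g t : torus R N).

Definition monom (m : 'cV[int]_N) g : Cstar R :=
  (\prod_i expgz (g i) (m i 0%R))%g.

Definition invariant_char G : {pred 'cV[int]_N} :=
  fun m => `[< forall g, G g -> monom m g = 1%g >].

Fact invariant_char_zmod_closed G : zmod_closed (invariant_char G).
Proof.
split=> [|m n /asboolP mG /asboolP nG]; apply/asboolP => g Gg; apply/val_inj.
  by rewrite /= cval_prod big1 // => i _; rewrite cvalXz mxE expr0z.
have /(congr1 (@cval R)) := mG _ Gg; have /(congr1 (@cval R)) := nG _ Gg.
rewrite /= !cval_prod.
under eq_bigr => i _ do rewrite cvalXz.
move=> n1; under eq_bigr => i _ do rewrite cvalXz.
move=> m1; under eq_bigr => i _.
  rewrite cvalXz !mxE expfzDr ?cval_neq0 // -invr_expz; over.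
by rewrite big_split prodfV /= n1 m1 invr1 mulr1.
Qed.
HB.instance Definition _ G :=
  GRing.isZmodClosed.Build _ (invariant_char G)
    (invariant_char_zmod_closed G).

(* M = F((C^x)^N / G), the lattice of G-invariant characters of (C^x)^N *)
Record invlat G := MkInvlat {
  invlat_val :> 'cV[int]_N;
  _ : invlat_val \in invariant_char G }.
HB.instance Definition _ G := [isSub for @invlat_val G].
HB.instance Definition _ G := [Choice of invlat G by <:].
HB.instance Definition _ G :=
  [SubChoice_isSubZmodule of invlat G by <:].

(* the identification of (C^x)^N with F((Z^N)^tau) given by the basis of
   (Z^N)^tau dual to the standard basis e_j = [delta_mx j 0] of Z^N: t sends
   the j-th dual basis vector to t_j *)
Definition torus_char_fun t (l : GRing.to_multiplicative (tau 'cV[int]_N)) :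
  Cstar R := (\prod_j expgz (t j) (tau_fun l (delta_mx j 0%R)))%g.

Fact torus_char_monoid_morphism t : monoid.monoid_morphism (torus_char_fun t).
Proof.
split=> [|k l]; apply/val_inj; rewrite /= !cval_prod /=.
  by apply: big1.
rewrite -big_split /=; apply: eq_bigr => j _; rewrite !cvalXz.
by rewrite -expfzDr ?cval_neq0.
Qed.
HB.instance Definition _ t :=
  isUMagmaMorphism.Build _ _ (torus_char_fun t)
    (torus_char_monoid_morphism t).
Definition torus_char t : F R (tau 'cV[int]_N) := torus_char_fun t.

(* The j-th monomial of W has the j-th column of P as exponent vector. *)
Variable P : 'M[nat]_N.

Definition torus_act g (x : 'cV[R[i]]_N) : 'cV[R[i]]_N :=
  \col_i (cval (g i) * x i 0).

Definition W (x : 'cV[R[i]]_N) : R[i] := \sum_j \prod_i x i 0 ^+ P i j.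

Definition W_invariant G : Prop :=
  forall g, G g -> forall x, W (torus_act g x) = W x.

Definition Pint : 'M[int]_N := map_mx Posz P.
Definition Prat : 'M[rat]_N := map_mx (fun n : nat => n%:R) P.

(* P = A o Btau, where A is the inclusion of M in Z^N *)
Definition factors G (Btau : {additive 'cV[int]_N -> invlat G}) : Prop :=
  forall v, \val (Btau v) = Pint *m v.

Lemma factors_unique G (B1 B2 : {additive 'cV[int]_N -> invlat G}) :
  factors B1 -> factors B2 -> B1 =1 B2.
Proof. by move=> f1 f2 v; apply/val_inj; rewrite f1 f2. Qed.

(* G^T = ker F(B), B = tau_map Btau, for the Btau such that P = A o Btau: it
   is unique, and the existential also asserts that it exists. *)
Definition GT G : set (torus R N) :=
  [set t | exists2 Btau : {additive 'cV[int]_N -> invlat G},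
     factors Btau & in_kerF (tau_map Btau) (torus_char t)].

(* the inverse of the transpose of P *)
Definition PtauV : 'M[rat]_N := invmx Prat^T.

Definition gcol (k : 'I_N) : torus R N :=
  [ffun i => exp2pii (ratr (PtauV i k))].
Definition grow (k : 'I_N) : torus R N :=
  [ffun i => exp2pii (ratr (PtauV k i))].

Definition Gdagger G : set (torus R N) :=
  [set t | exists2 r : 'rV[int]_N,
     t = (\prod_k expgz (grow k) (r 0%R k))%g &
     forall a : 'cV[int]_N,
       G (\prod_k expgz (gcol k) (a k 0%R))%g ->
       (map_mx intr r *m PtauV *m map_mx intr a) 0 0 \is a Num.int].

End Lattices.

(* Main.v *)
Require Import Defs.
From HB Require Import structures.
From mathcomp Require Import all_boot all_order all_algebra.
From mathcomp Require Import boolp classical_sets reals.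
From mathcomp Require Import complex trigo ring lra.

(* Since P is invertible, evaluating W at points of (C^x)^N where a single
   monomial is not 1 shows that every monomial of W is G-invariant, so every
   element of G is exp(2 pi i (P^tau)^{-1} a) for some a in Z^N.  Let Lam be the
   lattice of the a for which this element lies in G; it contains P^tau Z^N.
   Both G^dagger and G^T are the annihilator {t | t^a = 1 for all a in Lam}:
   for G^dagger by taking logarithms of t, and for G^T because b |-> b o B^tau
   identifies M^tau with Lam, by biduality of full-rank lattices. *)

Set Implicit Arguments.
Unset Strict Implicit.
Unset Printing Implicit Defensive.

Import Order.TTheory GRing.Theory Num.Theory.
Local Open Scope ring_scope.

(** * The map x -> exp(2 pi i x) from the reals to C^x: homomorphism, kernel and image *)

Section Exponential.
Variable R : realType.
Implicit Types (x y : R) (z : Cstar R) (n : int).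

Lemma cval_inj : injective (@cval R).
Proof. exact: val_inj. Qed.

Lemma exp2piiD x y : exp2pii (x + y) = (exp2pii x * exp2pii y)%g.
Proof.
apply/cval_inj => /=; rewrite mulrDr cosD sinD; apply/eqP.
by rewrite eq_complex /= eqxx [cos _ * sin _ + _]addrC eqxx.
Qed.

Lemma exp2pii0 : exp2pii (0 : R) = 1%g.
Proof. by apply/cval_inj; rewrite /= mulr0 cos0 sin0. Qed.

Lemma cval_exp2piiN x : cval (exp2pii (- x)) = (cval (exp2pii x))^-1.
Proof.
apply: (mulfI (cval_neq0 (exp2pii x))).
by rewrite -cvalM -exp2piiD subrr exp2pii0 divff ?cval_neq0.
Qed.

Lemma cval_exp2piiXz x n : cval (exp2pii x) ^ n = cval (exp2pii (n%:~R * x)).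
Proof.
have expX k : cval (exp2pii x) ^+ k = cval (exp2pii (k%:R * x)).
  elim: k => [|k IHk]; first by rewrite mul0r exp2pii0.
  by rewrite exprS IHk -cvalM -exp2piiD -[k.+1%:R]natr1 mulrDl mul1r addrC.
case: n => k; first exact: expX.
by rewrite -[LHS]/((_ ^+ k.+1)^-1) expX NegzE mulrNz mulNr cval_exp2piiN.
Qed.

Lemma exp2pii_int n : exp2pii (n%:~R : R) = 1%g.
Proof.
apply/cval_inj; rewrite -[n%:~R]mulr1 -cval_exp2piiXz.
suff -> : cval (exp2pii (1 : R)) = 1 by rewrite exp1rz.
by rewrite /= mulr1 mulrC mulr_natr cos2pi sin2pi.
Qed.

(** Subtracting the floor reduces to 0 <= f < 1. There cos(2 pi f) = 1 - 2 sin(pi f)^2, and sin is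
    positive on the open interval from 0 to pi, so f = 0. *)
Lemma exp2pii_eq1 x : (exp2pii x = 1%g) <-> (x \is a Num.int).
Proof.
split=> [x1|/intrP[n ->]]; last exact: exp2pii_int.
have /andP[le_nx lt_xn] := floor_itv x.
set n := Num.floor x in le_nx lt_xn; pose f := x - n%:~R.
have : exp2pii f = 1%g.
  rewrite exp2piiD x1; apply/cval_inj.
  by rewrite cvalM mul1r cval_exp2piiN exp2pii_int invr1.
move/(congr1 (@cval R)) => -[+ _].
have f_ge0 : 0 <= f by rewrite subr_ge0.
have f_lt1 : f < 1 by rewrite ltrBlDl -[1]/(1%:~R) -intrD.
have [f0|f_neq0] := eqVneq f 0.
  by move=> _; move/eqP: f0; rewrite subr_eq0 => /eqP->; exact: intr_int.
have f_gt0 : 0 < f by rewrite lt0r f_neq0.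
have sinf : 0 < sin (pi * f).
  apply: sin_gt0_pi; rewrite mulr_gt0 ?pi_gt0 //=.
  by rewrite -[ltRHS]mulr1 ltr_pM2l ?pi_gt0.
rewrite -mulrA mulr_natl cos_mulr2n cos2sin2 => /eqP.
by have := exprn_gt0 2 sinf => s2 /eqP c2; exfalso; clear x1; lra.
Qed.

Lemma exp2pii_unit_circle z : `|cval z| = 1 -> exists x, z = exp2pii x.
Proof.
case: z => -[a b] /= z0; rewrite normc_def /= => -[].
move=> /(congr1 (fun t => t ^+ 2)).
rewrite expr1n sqr_sqrtr ?addr_ge0 ?sqr_ge0 // => ab1.
have a_le1 : -1 <= a <= 1.
  rewrite -ler_norml -(@ler_pXn2r _ 2) ?nnegrE // expr1n.
  by rewrite real_normK ?num_real // -ab1 lerDl sqr_ge0.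
have sinE : sin (acos a) = `|b|.
  by rewrite sin_acos // -ab1 addrC addKr sqrtr_sqr.
have pi2 : 2 * pi != 0 :> R by rewrite mulf_neq0 ?pnatr_eq0 ?gt_eqF ?pi_gt0.
(* [acos a] lies where sin is nonnegative, so the sign of [b] decides the sign of the angle. *)
have [b0|b0] := leP 0 b.
  exists (acos a / (2 * pi)); apply/cval_inj.
  by rewrite /= mulrC divfK // acosK ?in_itv // sinE ger0_norm.
exists (- acos a / (2 * pi)); apply/cval_inj.
by rewrite /= mulrC divfK // cosN sinN acosK ?in_itv // sinE ltr0_norm // opprK.
Qed.

End Exponential.

Notation toQ := (map_mx (intr : int -> rat)).

(** * Biduality for full-rank sublattices of Z^N *)

Section Lattice.
Variables (N : nat) (S : zmodClosed 'rV[int]_N) (d : nat).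
Hypotheses (d_gt0 : (0 < d)%N) (dS : forall v : 'rV[int]_N, d%:Z *: v \in S).

(** Division by [d] of each coordinate shows that [S] is generated by its finitely many vectors with
    coordinates in [0, d), together with the multiples by [d] of the standard basis. The latter
    generators give [B]. *)
Lemma lattice_fin_gen : exists K (A : 'M[int]_(K, N)),
  (forall v, v \in S <-> exists u, v = u *m A)
  /\ exists B, B *m A = (d%:Z)%:M.
Proof.
pose T := {ffun 'I_N -> 'I_d}.
pose r (k : 'I_#|T|) : 'rV[int]_N := \row_j (enum_val k j)%:Z.
(* One row per residue vector; those outside [S] are replaced by 0, which lies in [S]. *)
pose A1 := \matrix_k (if r k \in S then r k else 0).
have ZS (n : int) (v : 'rV[int]_N) : v \in S -> n *: v \in S.
  by move=> vS; rewrite -[n]intz scaler_int rpredMz.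
have A1S (w : 'rV[int]_#|T|) : w *m A1 \in S.
  rewrite mulmx_sum_row rpred_sum // => k _; rewrite rowK ZS //.
  by case: ifP => // _; rewrite rpred0.
exists (#|T| + N)%N, (col_mx A1 (d%:Z)%:M); split; last first.
  by exists (row_mx 0 1%:M); rewrite mul_row_col mul0mx mul1mx add0r.
move=> v; split=> [vS|[u ->]]; last first.
  rewrite -[u]hsubmxK mul_row_col rpredD // mul_mx_scalar; exact: dS.
have lt_mod (j : 'I_N) : (`|(v 0%R j %% d)%Z|%N < d)%N.
  rewrite -ltz_nat gez0_abs ?modz_ge0 ?ltz_pmod //.
  by rewrite eqz_nat -lt0n.
pose f : T := [ffun j => Ordinal (lt_mod j)].
pose q : 'rV[int]_N := \row_j (v 0%R j %/ d)%Z.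
have vE : v = r (enum_rank f) + d%:Z *: q.
  apply/rowP => j; rewrite !mxE enum_rankK ffunE /=.
  rewrite gez0_abs ?modz_ge0 ?eqz_nat -?lt0n // mulrC addrC.
  exact: divz_eq.
have rS : r (enum_rank f) \in S.
  by rewrite -[r _](addrK (d%:Z *: q)) -vE rpredB.
exists (row_mx (delta_mx 0 (enum_rank f)) q).
by rewrite mul_row_col -rowE rowK rS mul_mx_scalar -vE.
Qed.

(* Smith normal form yields a basis of S, and m below runs over the dual one. *)
Lemma lattice_bidual (a : 'rV[int]_N) :
  (forall m : 'cV[rat]_N,
     (forall v, v \in S -> (toQ v *m m) 0 0 \is a Num.int) ->
   (toQ a *m m) 0 0 \is a Num.int) ->
  a \in S.
Proof.
move=> aP; have [K [A [SP [B BA]]]] := lattice_fin_gen.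
have [L Lu [U Uu [s _ AE]]] := int_Smith_normal_form A.
set D := (X in L *m X *m U) in AE.
have BLD : B *m L *m D = d%:Z *: invmx U.
  have : B *m L *m D *m U = (d%:Z)%:M by rewrite -BA AE !mulmxA.
  by move/(congr1 (mulmx^~ (invmx U))); rewrite mulmxK // mul_scalar_mx.
(* Full rank: an invertible matrix times [d] has no zero column, so neither has [D], whose only
   possible nonzero entry in column [j] is the diagonal one. *)
have colBLD (j : 'I_N) : (exists k : 'I_K, k = j :> nat) /\ s`_j != 0.
  have : exists i, (B *m L *m D) i j != 0.
    apply/existsP; apply: contraT; rewrite negb_exists => /forallP BLD0.
    have : (U *m (B *m L *m D)) j j = 0.
      rewrite mxE big1 // => i _.
      by have := BLD0 i; rewrite negbK => /eqP->; rewrite mulr0.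
    rewrite BLD -scalemxAr mulmxV // !mxE eqxx mulr1 => /eqP.
    by rewrite eqz_nat eqn0Ngt d_gt0.
  case=> i; rewrite mxE => nz.
  have : exists k, (B *m L) i k * D k j != 0.
    apply/existsP; apply: contraR nz; rewrite negb_exists => /forallP BLD0.
    apply/eqP; rewrite big1 // => k _.
    by have := BLD0 k; rewrite negbK => /eqP.
  case=> k; rewrite !mxE.
  have [kj|_] := eqVneq (k : nat) j; last by rewrite mulr0 eqxx.
  rewrite mulr1n kj mulf_eq0 negb_or => /andP[_ sj]; split=> //.
  by exists k.
have mulD n (u : 'M[int]_(n, K)) i (j : 'I_N) (k : 'I_K) :
    k = j :> nat -> (u *m D) i j = u i k * s`_j.
  move=> kj; rewrite mxE (bigD1 k) //= big1 => [|l lk].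
    by rewrite !mxE kj eqxx mulr1n addr0.
  rewrite !mxE -kj; case: eqP => [/val_inj lk'|_]; last by rewrite mulr0.
  by rewrite lk' eqxx in lk.
have aU (j : 'I_N) : exists c : int, (a *m invmx U) 0 j = c * s`_j.
  have [[k kj] sj] := colBLD j.
  have sjQ : (s`_j)%:~R != 0 :> rat by rewrite intr_eq0.
  (* The rows of [U] scaled by the invariant factors form a basis of [S]; this is the [j]-th vector
     of its dual basis. *)
  pose m : 'cV[rat]_N := (s`_j)%:~R^-1 *: toQ (col j (invmx U)).
  have mE v : (toQ v *m m) 0 0 = ((v *m invmx U) 0 j)%:~R / (s`_j)%:~R.
    by rewrite -scalemxAr -map_mxM !mxE mulrC; under eq_bigr do rewrite mxE.
  have /aP : forall v, v \in S -> (toQ v *m m) 0 0 \is a Num.int.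
    move=> v /SP[u ->]; rewrite mE AE !mulmxA mulmxK // (mulD _ _ _ _ _ kj).
    by rewrite intrM mulfK // intr_int.
  rewrite mE => /intrP[c cE]; exists c; apply/(intr_inj (R := rat)).
  by rewrite intrM -cE divfK.
have [c cE] := fin_all_exists aU.
(* Coordinates with index at least [N] meet zero rows of [D], so the default 0 is harmless. *)
pose c' : 'rV[int]_K := \row_k (if insub (k : nat) is Some j then c j else 0).
apply/SP; exists (c' *m invmx L); rewrite AE !mulmxA mulmxKV //.
rewrite -[LHS](mulmxKV Uu); congr (_ *m _); apply/rowP => j.
have [[k kj] _] := colBLD j.
rewrite (mulD _ _ _ _ _ kj) cE mxE kj; case: insubP => [j' _ /val_inj -> //|].
by rewrite ltn_ord.
Qed.

End Lattice.

(** * Monomials on the torus and rational logarithms of its points *)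

Section Torus.
Variables (R : realType) (N : nat).
Implicit Types (g t : torus R N) (m : 'cV[int]_N) (x : 'cV[rat]_N).

Definition texp x : torus R N := [ffun i => exp2pii (ratr (x i 0))].

Lemma cval_monom m g : cval (monom m g) = \prod_i cval (g i) ^ m i 0.
Proof. by rewrite cval_prod; apply: eq_bigr => i _; rewrite cvalXz. Qed.

Lemma cval_prod_exp2pii (I : finType) (f : I -> R) :
  \prod_i cval (exp2pii (f i)) = cval (exp2pii (\sum_i f i)).
Proof.
elim/big_ind2: _ => [|y x z u -> ->|//]; first by rewrite exp2pii0.
by rewrite exp2piiD.
Qed.

Lemma monom_exp2pii m (x : 'I_N -> R) :
  monom m [ffun i => exp2pii (x i)] = exp2pii (\sum_i (m i 0)%:~R * x i).
Proof.
apply/cval_inj; rewrite cval_monom -cval_prod_exp2pii.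
by apply: eq_bigr => i _; rewrite ffunE cval_exp2piiXz.
Qed.

Lemma monom_texp m x : monom m (texp x) = exp2pii (ratr (((toQ m)^T *m x) 0 0)).
Proof.
rewrite monom_exp2pii mxE rmorph_sum; congr exp2pii; apply: eq_bigr => i _.
by rewrite !mxE rmorphM /= ratr_int.
Qed.

Lemma monom_texp_eq1 m x :
  monom m (texp x) = 1%g <-> ((toQ m)^T *m x) 0 0 \is a Num.int.
Proof.
rewrite monom_texp; split=> [/exp2pii_eq1 /intrP[n]|/intrP[n ->]].
  by rewrite -(ratr_int R) => /fmorph_inj ->; exact: intr_int.
by rewrite ratr_int exp2pii_int.
Qed.

Lemma prod_texp n (f : 'I_n -> 'cV[rat]_N) (a : 'I_n -> int) :
  (\prod_k expgz (texp (f k)) (a k))%g = texp (\sum_k (a k)%:~R *: f k).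
Proof.
have prodE (I : finType) (h : I -> torus R N) i :
    (\prod_k h k)%g i = (\prod_k h k i)%g.
  by apply: (big_morph (fun g : torus R N => g i)) => [g t|]; rewrite ffunE.
have expE g i n0 : expgz g n0 i = expgz (g i) n0.
  have expE k : (g ^+ k)%g i = (g i ^+ k)%g.
    by elim: k => [|k IHk]; rewrite ?expgS ffunE ?IHk.
  by case: n0 => k /=; rewrite ?ffunE expE.
apply/ffunP => i; rewrite prodE ffunE; apply/cval_inj.
rewrite cval_prod summxE rmorph_sum -cval_prod_exp2pii.
apply: eq_bigr => k _; rewrite expE cvalXz ffunE cval_exp2piiXz mxE rmorphM /=.
by rewrite ratr_int.
Qed.

(** The exponent is an integer combination of the columns of [Q], so the monomial is a product of
    powers of the column monomials. *)
Lemma monom_mul (Q : 'M[int]_N) m g :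
  (forall j, monom (col j Q) g = 1%g) -> monom (Q *m m) g = 1%g.
Proof.
move=> Qg; apply/cval_inj; rewrite cval_monom.
transitivity (\prod_i \prod_j (cval (g i) ^ Q i j) ^ m j 0).
  apply: eq_bigr => i _; rewrite mxE.
  rewrite (big_morph (fun n => cval (g i) ^ n) (id1 := 1) (op1 := *%R)) //.
    by apply: eq_bigr => j _; rewrite exprz_exp.
  by move=> n1 n2; rewrite expfzDr ?cval_neq0.
rewrite exchange_big big1 // => j _.
have := congr1 (@cval R) (Qg j); rewrite cval_monom => gj.
transitivity ((\prod_i cval (g i) ^ col j Q i 0) ^ m j 0); last first.
  by rewrite gj cval1 exp1rz.
rewrite [RHS](big_morph (fun z => z ^ m j 0) (id1 := 1) (op1 := *%R))
  ?exp1rz //.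
  by apply: eq_bigr => i _; rewrite mxE.
by move=> y z; rewrite expfzMl.
Qed.

(** The coordinates of [g] turn out to be roots of unity, hence have real logarithms x. The
    hypothesis on columns then says that the transpose of [Q] sends x to an integer vector, and this
    system is solved for x. *)
Lemma torus_log (Q : 'M[int]_N) g : \det Q != 0 ->
  (forall j, monom (col j Q) g = 1%g) ->
  exists a : 'cV[int]_N, g = texp (invmx (toQ Q)^T *m toQ a).
Proof.
move=> Q0 Qg.
have g1 i : `|cval (g i)| = 1.
  (* [Q] times this exponent is [\det Q] times the [i]-th basis vector, so the power of [g i] with
     exponent [\det Q] is 1. *)
  have := monom_mul (\adj Q *m delta_mx i 0) Qg.
  rewrite mulmxA mul_mx_adj mul_scalar_mx.
  move=> /(congr1 (@cval R)); rewrite cval_monom (bigD1 i) //= big1.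
    rewrite !mxE !eqxx /= !mulr1 => /(congr1 Num.norm); rewrite normr1 => gD.
    have gX n : `|cval (g i) ^+ n.+1| = 1 -> `|cval (g i)| = 1.
      by rewrite normrX => /eqP; rewrite pexpr_eq1 // => /eqP.
    case: (\det Q) Q0 gD => [[//|n] _|n _]; first exact: gX.
    rewrite -[X in `|X|]/((_ ^+ n.+1)^-1) normrV ?unitfE ?expf_neq0 ?cval_neq0 //.
    by move=> /(congr1 (@GRing.inv _)); rewrite invrK invr1 => /gX.
  by move=> j /negPf ji; rewrite !mxE ji /= mulr0 expr0z.
have [x xE] := fin_all_exists (fun i => exp2pii_unit_circle (g1 i)).
have gE : g = [ffun i => exp2pii (x i)] by apply/ffunP => i; rewrite ffunE.
have Qx j : exists n : int, \sum_i (Q i j)%:~R * x i = n%:~R.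
  apply/intrP/exp2pii_eq1; rewrite -(Qg j) gE monom_exp2pii; congr exp2pii.
  by apply: eq_bigr => i _; rewrite mxE.
have [n nE] := fin_all_exists Qx.
exists (\col_j n j); rewrite gE; apply/ffunP => i; rewrite !ffunE; congr exp2pii.
(* The logarithms are real while the inverse matrix is rational, so the system is solved over [R]
   and the solution recognised as an image under [ratr]. *)
pose QR := map_mx (ratr : rat -> R) (toQ Q)^T; pose X := \col_i x i.
have QRu : (toQ Q)^T \in unitmx.
  by rewrite unitmxE unitfE det_tr det_map_mx intr_eq0.
have QX : QR *m X = map_mx ratr (toQ (\col_j n j)).
  apply/colP => j; rewrite !mxE ratr_int -nE; apply: eq_bigr => k _.
  by rewrite !mxE ratr_int.
have -> : x i = X i 0 by rewrite mxE.
rewrite -(mulKmx (_ : QR \in unitmx) X); last by rewrite map_unitmx.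
by rewrite QX -map_invmx -map_mxM mxE.
Qed.

End Torus.

(** * Invariance of each monomial of W under G *)

Section Main.
Variables (R : realType) (N : nat) (P : 'M[nat]_N) (G : set (torus R N)).
Hypothesis G_group : group_closed [in G].
Hypothesis WG : W_invariant P G.
Hypothesis P_unit : Prat P \in unitmx.
Implicit Types (g t : torus R N) (a m : 'cV[int]_N).

Local Notation PQ := (toQ (Pint P)).
Local Notation V := (PtauV P).

Lemma Prat_toQ : Prat P = PQ. Proof. by apply/matrixP => i j; rewrite !mxE. Qed.

Lemma PQ_unit : PQ \in unitmx. Proof. by rewrite -Prat_toQ. Qed.

Lemma VE : V = invmx PQ^T. Proof. by rewrite /PtauV Prat_toQ. Qed.

Lemma trVE : V^T = invmx PQ. Proof. by rewrite VE trmx_inv trmxK. Qed.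

Lemma det_Pint_neq0 : \det (Pint P) != 0.
Proof. by have := PQ_unit; rewrite unitmxE unitfE det_map_mx intr_eq0. Qed.

Lemma monom_colP g j : G g -> monom (col j (Pint P)) g = 1%g.
Proof.
move=> Gg; pose c k := cval (monom (col k (Pint P)) g).
suff : c j = 1 by move=> c1; apply: cval_inj.
(* A one-parameter subgroup along row [j] of the adjugate: the [k]-th monomial of W takes the value
   [s ^ (\adj (Pint P) *m Pint P) j k], so only the [j]-th one varies with [s]. *)
pose x (s : R[i]) : 'cV_N := \col_i s ^ (\adj (Pint P) j i).
have Wact y : W P (torus_act g y) = \sum_k c k * \prod_i y i 0 ^+ P i k.
  apply: eq_bigr => k _; rewrite /c cval_monom -big_split; apply: eq_bigr => i _.
  by rewrite !mxE exprMn.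
have monx s k : s != 0 ->
    \prod_i x s i 0 ^+ P i k = s ^ (\det (Pint P) *+ (j == k)).
  move=> s0.
  have <- : (\adj (Pint P) *m Pint P) j k = \det (Pint P) *+ (j == k).
    by rewrite mul_adj_mx mxE.
  rewrite mxE [RHS](big_morph (fun n => s ^ n) (id1 := 1) (op1 := *%R)) //.
    by apply: eq_bigr => i _; rewrite [x s i 0]mxE [Pint P i k]mxE -exprz_exp.
  by move=> n1 n2; rewrite expfzDr.
have key s : s != 0 ->
    \sum_(k | k != j) c k + c j * s ^ \det (Pint P)
    = (\sum_(k | k != j) 1) + s ^ \det (Pint P).
  move=> s0; have := WG Gg (x s).
  rewrite Wact /W (bigD1 j) //= [RHS](bigD1 j) //=.
  have mon1 k : k != j -> \prod_i x s i 0 ^+ P i k = 1.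
    by move=> /negPf kj; rewrite monx // eq_sym kj mulr0n expr0z.
  rewrite monx // eqxx mulr1n.
  under eq_bigr => k kj do rewrite (mon1 k kj) mulr1.
  under [in RHS]eq_bigr => k kj do rewrite (mon1 k kj).
  by rewrite addrC => ->; rewrite addrC.
have two0 : 2 != 0 :> R[i] by rewrite pnatr_eq0.
(* Subtracting the identities at [s] = 2 and [s] = 1 cancels the other monomials; 2 to the power
   [\det (Pint P)] is not 1 because the determinant is nonzero. *)
have := key 2 two0; have := key 1 (oner_neq0 _).
rewrite exp1rz; set d := 2 ^ _ => e1 e2.
have d1 : d != 1.
  rewrite /d; case: (\det _) det_Pint_neq0 => [[//|n] _|n _].
    by rewrite -exprnP pexprn_eq1 ?ler0n //= pnatr_eq1.
  rewrite -[_ ^ _]/((_ ^+ n.+1)^-1) invr_eq1 pexprn_eq1 ?ler0n //=.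
  by rewrite pnatr_eq1.
have : (c j - 1) * (d - 1) = 0.
  move: e1 e2; move: (c j) (\sum_(k | _) c k) (\sum_(k | _) 1) => z A B e1 e2.
  have -> : (z - 1) * (d - 1) = (A + z * d) - (A + z * 1) - d + 1.
    by ring.
  by rewrite e2 e1; ring.
by move/eqP; rewrite mulf_eq0 !subr_eq0 (negPf d1) orbF => /eqP.
Qed.

(** * The lattice of logarithms of G, and the Krawitz dual as its annihilator *)

Definition Lam a := G (texp R (V *m toQ a)).

Lemma prod_gcol a :
  (\prod_k expgz (gcol R P k) (a k 0%R))%g = texp R (V *m toQ a).
Proof.
rewrite (eq_bigr (fun k => expgz (texp R (col k V)) (a k 0))) => [|k _].
  rewrite prod_texp; congr texp; apply/colP => i; rewrite summxE mxE.
  by apply: eq_bigr => k _; rewrite !mxE mulrC.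
by congr expgz; apply/ffunP => i; rewrite !ffunE mxE.
Qed.

Lemma prod_grow (r : 'rV[int]_N) :
  (\prod_k expgz (grow R P k) (r 0%R k))%g = texp R (V^T *m toQ r^T).
Proof.
rewrite (eq_bigr (fun k => expgz (texp R (row k V)^T) (r 0 k))) => [|k _].
  rewrite prod_texp; congr texp; apply/colP => i; rewrite summxE mxE.
  by apply: eq_bigr => k _; rewrite !mxE mulrC.
by congr expgz; apply/ffunP => i; rewrite !ffunE !mxE.
Qed.

(** [V] inverts the transpose of [P], so the point is the exponential of an integer vector, hence
    the identity. *)
Lemma Lam_PT w : Lam ((Pint P)^T *m w).
Proof.
rewrite /Lam; suff -> : texp R (V *m toQ ((Pint P)^T *m w)) = 1%g.
  by have [] := G_group; rewrite in_setE.
rewrite map_mxM -map_trmx VE mulKmx ?unitmx_tr ?PQ_unit //.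
by apply/ffunP => i; rewrite !ffunE !mxE ratr_int exp2pii_int.
Qed.

Lemma G_texp g : G g -> exists2 a, Lam a & g = texp R (V *m toQ a).
Proof.
move=> Gg; have [a gE] := torus_log det_Pint_neq0 (fun j => monom_colP j Gg).
by exists a; rewrite /Lam VE -gE.
Qed.

(** For [t] a product of powers of the [grow R P k], the integrality condition of [Gdagger] concerns
    exactly the logarithm of [monom a t]. Every annihilating [t] is such a product: it kills the
    columns of the transpose of [P] by [Lam_PT], and [torus_log] applies. *)
Lemma GdaggerE t : Gdagger P G t <-> (forall a, Lam a -> monom a t = 1%g).
Proof.
have scalar_tr (A : 'M[rat]_1) : A 0 0 = A^T 0 0 by rewrite mxE.
split=> [[r -> rP] a La|tP].
  rewrite prod_grow; apply/monom_texp_eq1.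
  rewrite scalar_tr !trmx_mul !trmxK map_trmx trmxK.
  by apply: rP; rewrite prod_gcol.
have [b tE] : exists b, t = texp R (V^T *m toQ b).
  have := @torus_log R N (Pint P)^T t; rewrite det_tr => /(_ det_Pint_neq0).
  case=> [j|b ->]; first by rewrite colE; exact/tP/Lam_PT.
  by exists b; rewrite map_trmx trmxK trVE.
exists b^T; first by rewrite prod_grow trmxK.
move=> a; rewrite prod_gcol => /tP; rewrite tE => /monom_texp_eq1.
by rewrite scalar_tr !trmx_mul !trmxK map_trmx.
Qed.

(** * The group G^T as the annihilator of the same lattice *)

Lemma torus_charE t (H : zmodType) (B : {additive 'cV[int]_N -> H}) (b : tau H) :
  F_fun (torus_char t) (tau_map B b)
  = monom (\col_j tau_fun b (B (delta_mx j 0))) t.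
Proof. by apply: eq_bigr => j _; rewrite mxE. Qed.

(** Pairing with [V *m toQ a] is integral on invariant characters, hence an element [b] of M^tau.
    Composed with [B] it sends the [j]-th basis vector to [a j 0], since [V] cancels the transpose
    of [P]. *)
Lemma GT_monom t a : GT P G t -> Lam a -> monom a t = 1%g.
Proof.
move=> [B BE tB] La.
pose q (m : invlat G) : rat := ((toQ (\val m))^T *m (V *m toQ a)) 0 0.
have qint (m : invlat G) : q m \is a Num.int.
  by apply/(monom_texp_eq1 R); have /asboolP := valP m; exact.
(* The floor only converts the rational [q m], already known to be integral, to type [int]. *)
pose f (m : invlat G) : int := Num.floor (q m).
have fE (m : invlat G) : (f m)%:~R = q m by rewrite floorK.
have f_add : nmod_morphism f.
  split=> [|m n]; apply/(intr_inj (R := rat)).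
    by rewrite fE /q /= map_mx0 trmx0 mul0mx mxE.
  by rewrite intrD !fE /q /= map_mxD linearD mulmxDl mxE.
pose b : tau (invlat G) := HB.pack f (GRing.isNmodMorphism.Build _ _ f f_add).
rewrite -(tB b) [RHS]torus_charE; congr monom; apply/colP => j.
rewrite mxE; apply/(intr_inj (R := rat)); rewrite [RHS]fE /q BE map_mxM trmx_mul.
rewrite VE -mulmxA mulKVmx ?unitmx_tr ?PQ_unit // map_delta_mx trmx_delta.
by rewrite -rowE !mxE.
Qed.

(** Row vectors, as [lattice_bidual] expects. *)
Definition LamT : {pred 'rV[int]_N} := fun v => `[< Lam v^T >].

Fact LamT_zmod_closed : zmod_closed LamT.
Proof.
split=> [|v w /asboolP Lv /asboolP Lw]; apply/asboolP.
  by rewrite trmx0 -(mulmx0 _ (Pint P)^T); exact: Lam_PT.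
rewrite /Lam.
have -> : texp R (V *m toQ (v - w)^T)
    = (texp R (V *m toQ v^T) / texp R (V *m toQ w^T))%g.
  apply/ffunP => i; rewrite !ffunE linearB map_mxB mulmxBr !mxE rmorphB.
  rewrite exp2piiD /=.
  by congr (_ * _)%g; apply/cval_inj; rewrite cval_exp2piiN.
have [_ GB] := G_group.
have := GB (texp R (V *m toQ v^T)) (texp R (V *m toQ w^T)).
by rewrite !in_setE; apply.
Qed.

(** By biduality it suffices to pair [a] with each [x] in the dual of [Lam]. Then [P] maps [x] to an
    invariant character [m], and the pairing equals the integer [b] takes at [m]. *)
Lemma Lam_tau (B : {additive 'cV[int]_N -> invlat G}) (b : tau (invlat G)) :
  factors P B -> Lam (\col_j tau_fun b (B (delta_mx j 0))).
Proof.
move=> BE; set a := \col_j _.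
pose S : zmodClosed 'rV[int]_N := HB.pack LamT
  (GRing.isZmodClosed.Build _ LamT LamT_zmod_closed).
have inS v : (v \in S) = `[< Lam v^T >] by [].
pose D := \det (Pint P).
have DS (v : 'rV[int]_N) : D *: v \in S.
  rewrite inS; apply/asboolP; rewrite linearZ /=.
  suff -> : D *: v^T = (Pint P)^T *m ((\adj (Pint P))^T *m v^T) by exact: Lam_PT.
  by rewrite mulmxA -trmx_mul mul_adj_mx tr_scalar_mx mul_scalar_mx.
have bB w : tau_fun b (B w) = (a^T *m w) 0 0.
  rewrite [w in LHS]matrix_sum_delta exchange_big big_ord1.
  under eq_bigr => j _ do rewrite -[w j ord0]intz scaler_int.
  rewrite raddf_sum [LHS](raddf_sum (b : {additive invlat G -> int})) mxE.
  apply: eq_bigr => j _.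
  by rewrite raddfMz [LHS](raddfMz (b : {additive invlat G -> int})) !mxE mulrzz.
suff : a^T \in S by rewrite inS trmxK => /asboolP.
apply: (@lattice_bidual N S `|D|%N) => [|v|x xP].
- by rewrite absz_gt0 det_Pint_neq0.
- rewrite abszE; case: (ger0P D) => _; first exact: DS.
  by rewrite scaleNr rpredN; exact: DS.
have [m mE] : exists m, toQ m = PQ *m x.
  have mx i : exists n : int, (PQ *m x) i 0 = n%:~R.
    apply/intrP; have : (toQ (row i (Pint P)) *m x) 0 0 \is a Num.int.
      apply: xP; rewrite inS; apply/asboolP.
      by rewrite tr_row colE; exact: Lam_PT.
    by rewrite map_row -row_mul mxE.
  have [n nE] := fin_all_exists mx; exists (\col_i n i).
  by apply/colP => i; rewrite !mxE -nE mxE.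
have mG : m \in invariant_char G.
  (* On the element of G with logarithm [V *m toQ c], the character [m] has as its logarithm the
     pairing of [x] with [c], integral as [c] is in [Lam]. *)
  apply/asboolP => g /G_texp[c Lc ->]; apply/monom_texp_eq1.
  rewrite mE trmx_mul VE -mulmxA mulKVmx ?unitmx_tr ?PQ_unit //.
  have -> : (x^T *m toQ c) 0 0 = (toQ c^T *m x) 0 0.
    by rewrite -[in RHS]map_trmx -[x in RHS]trmxK -trmx_mul [RHS]mxE.
  by apply: xP; rewrite inS trmxK; apply/asboolP.
pose mM : invlat G := MkInvlat mG.
(* [x] may be fractional, but [\adj (Pint P) *m m] is [D] times [x] and integral, so [B] applies to
   it; [D] is cancelled at the end. *)
have bm : D * tau_fun b mM = (a^T *m (\adj (Pint P) *m m)) 0 0.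
  rewrite -bB; have -> : B (\adj (Pint P) *m m) = mM *~ D.
    apply/val_inj; rewrite BE mulmxA mul_mx_adj mul_scalar_mx raddfMz.
    by rewrite -scaler_int intz.
  by rewrite [RHS](raddfMz (b : {additive invlat G -> int})) mulrC mulrzz.
have D0 : D%:~R != 0 :> rat by rewrite intr_eq0 det_Pint_neq0.
apply/intrP; exists (tau_fun b mM); apply: (mulfI D0).
rewrite -intrM bm; transitivity ((toQ a^T *m toQ (\adj (Pint P) *m m)) 0 0).
  have -> : toQ (\adj (Pint P) *m m) = D%:~R *: x.
    rewrite map_mxM mE mulmxA -map_mxM mul_adj_mx map_scalar_mx.
    by rewrite mul_scalar_mx.
  by rewrite -scalemxAr [RHS]mxE.
by rewrite -map_mxM mxE.
Qed.

Lemma GTE t : GT P G t <-> (forall a, Lam a -> monom a t = 1%g).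
Proof.
split=> [Gt a|tL]; first exact: GT_monom.
(* This supplies the existence of the factorisation through M that [GT] asserts. *)
have PG v : Pint P *m v \in invariant_char G.
  by apply/asboolP => g Gg; apply: monom_mul => j; exact: monom_colP.
pose B0 v : invlat G := MkInvlat (PG v).
have B0_add : nmod_morphism B0.
  by split=> [|v w]; apply/val_inj; rewrite /= ?mulmx0 ?mulmxDr.
pose B : {additive 'cV[int]_N -> invlat G} :=
  HB.pack B0 (GRing.isNmodMorphism.Build _ _ B0 B0_add).
have BE : factors P B by [].
by exists B => // b; rewrite [LHS]torus_charE; exact/tL/Lam_tau.
Qed.

End Main.

Theorem theoremA4 (R : realType) (N : nat) (P : 'M[nat]_N)
    (G : set (torus R N)) :
  group_closed [in G] ->
  W_invariant P G ->
  Prat P \in unitmx ->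
  Gdagger P G = GT P G.
Proof.
move=> G_group WG P_unit; apply/seteqP; split=> t.
  by move/(GdaggerE G_group P_unit)/(GTE G_group WG P_unit).
by move/(GTE G_group WG P_unit)/(GdaggerE G_group P_unit).
Qed.
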